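(* Let $\bar x\in X$ be a stationary point of the minmax problem $(P)$ with corresponding $\bar y\in S(\bar x)$ and multipliers $(\bar\lambda_O,\bar s_O,\bar\lambda_I,\bar s_I)$, and suppose that the pair $(\bar x,\bar y)$ satisfies the conditions ILICQ, ISCS, ISOSC, OLICQ, OSCS and OSOSC. Then $\bar x$ is a strict local minimal point of the problem $\min_{x\in X}\varphi(x)$, i.e. there is a neighborhood $U$ of $\bar x$ with $\varphi(\bar x)<\varphi(x)$ for all $x\in (U\cap X)\setminus\{\bar x\}$.
   Context: Setting. Let $Q_{11}\in\mathbb{R}^{n\times n}$, $Q_{22}\in\mathbb{R}^{m\times m}$ be symmetric positive semidefinite, $Q_{12}\in\mathbb{R}^{n\times m}$, $c_x\in\mathbb{R}^n$, $c_y\in\mathbb{R}^m$, $A_O\in\mathbb{R}^{p\times n}$, $b_O\in\mathbb{R}^p$, $A_I\in\mathbb{R}^{q\times n}$, $B_I\in\mathbb{R}^{q\times m}$, $b_I\in\mathbb{R}^q$ with $p<n$, $q<m$. Put $f(x,y)=\frac12x^\top Q_{11}x+x^\top Q_{12}y-\frac12y^\top Q_{22}y+c_x^\top x+c_y^\top y$, $X=\{x\in\mathbb{R}^n: A_Ox=b_O,\ x\ge0\}$, $Y(x)=\{y\in\mathbb{R}^m: A_Ix+B_Iy=b_I,\ y\ge0\}$ (vector inequalities are componentwise). The problem $(P)$ is $\min_{x\in X}\max_{y\in Y(x)}f(x,y)$. Let $S(x)=\arg\max_{y\in Y(x)}f(x,y)$; standing assumption: $S(x)\ne\emptyset$ for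 all $x\in X$. Let $\varphi(x)=\max_{y\in Y(x)}f(x,y)$. Stationarity. $\circ$ is the Hadamard (componentwise) product. A point $\bar x\in X$ is stationary for $(P)$ with $\bar y\in S(\bar x)$ and multipliers $(\bar\lambda_O,\bar s_O)\in\mathbb{R}^p\times\mathbb{R}^n$, $(\bar\lambda_I,\bar s_I)\in\mathbb{R}^q\times\mathbb{R}^m$ if $(x,y,\lambda_O,s_O,\lambda_I,s_I)=(\bar x,\bar y,\bar\lambda_O,\bar s_O,\bar\lambda_I,\bar s_I)$ solves the outer KKT system $Q_{11}x+Q_{12}y+c_x+A_I^\top\lambda_I+A_O^\top\lambda_O-s_O=0$, $A_Ox-b_O=0$, $x\circ s_O=0$, $x,s_O\ge0$, and the inner KKT system $-Q_{22}y+Q_{12}^\top x+c_y+B_I^\top\lambda_I+s_I=0$, $A_Ix+B_Iy-b_I=0$, $y\circ s_I=0$, $y,s_I\ge0$. Conditions. Let $\mathcal I_{\bar x}=\{i:\bar x_i=0\}$, $\mathcal I_{\bar y}=\{j:\bar y_j=0\}$; let $E_{\bar x}$ and $E_{\bar y}$ be the matrices whose rows are the transposed standard unit vectors $(e_n^i)^\top$, $i\in\mathcal I_{\bar x}$, and $(e_m^j)^\top$, $j\in\mathcal I_{\bar y}$, respectively. - OLICQ: $[A_O^\top,E_{\bar x}^\top]$ has full column rank. - ILICQ: $[B_I^\top,E_{\bar y}^\top]$ has full column rank. (Under ILICQ the inner multipliers are unique; under ILICQ and OLICQ the outer ones are too.) - ISCS: $\min_{i=1,\dots,m}([\bar s_I]_i+\bar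 y_i)>0$. - OSCS: $\min_{i=1,\dots,n}([\bar s_O]_i+\bar x_i)>0$. - ISOSC: $\eta^\top(-Q_{22})\eta<0$ for all $\eta\in T(\bar y,Y(\bar x))\setminus\{0\}$, where $T(\bar y,Y(\bar x))=\ker\begin{bmatrix}B_I \\ E_{\bar y}\end{bmatrix}$. - OSOSC (formulated under ILICQ, ISCS, ISOSC): $d^\top Q_{11}'d>0$ for all $d\in T(\bar x,X)\setminus\{0\}$, where $T(\bar x,X)=\ker\begin{bmatrix}A_O \\ E_{\bar x}\end{bmatrix}$ and $$Q_{11}'=Q_{11}-\begin{bmatrix}Q_{12}&A_I^\top&0\end{bmatrix}\begin{bmatrix}-Q_{22}&B_I^\top&E_{\bar y}^\top \\ B_I&0&0 \\ E_{\bar y}&0&0\end{bmatrix}^{-1}\begin{bmatrix}Q_{12}^\top \\ A_I \\ 0\end{bmatrix}$$ (the inverted matrix is nonsingular under ILICQ and ISOSC). *)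

(* Defs.v *)
From HB Require Import structures.
From mathcomp Require Import all_boot all_order all_algebra.
From mathcomp Require Import all_classical all_reals all_analysis.
Set Implicit Arguments.
Unset Strict Implicit.
Unset Printing Implicit Defensive.
Import Order.TTheory GRing.Theory Num.Theory.
Import numFieldNormedType.Exports.
Local Open Scope classical_set_scope.
Local Open Scope ring_scope.

Definition quad_form (R : realType) (k : nat) (Q : 'M[R]_k) (v : 'cV[R]_k) : R :=
  (v^T *m Q *m v) 0 0.

Definition sym_psd (R : realType) (k : nat) (Q : 'M[R]_k) : Prop :=
  Q^T = Q /\ forall v : 'cV[R]_k, 0 <= quad_form Q v.

Definition nonneg_vec (R : realType) (k : nat) (v : 'cV[R]_k) : Prop :=
  forall i, 0 <= v i 0.

Definition hadamard (R : realType) (k : nat) (u v : 'cV[R]_k) : 'cV[R]_k :=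
  map2_mx *%R u v.

Definition zero_idx (R : realType) (k : nat) (v : 'cV[R]_k) : {set 'I_k} :=
  [set i | v i 0 == 0]%SET.

(* E_v: its rows are the transposed unit vectors of the active indices. *)
Definition active_mx (R : realType) (k : nat) (v : 'cV[R]_k) :
    'M[R]_(#|zero_idx v|, k) :=
  \matrix_(r < #|zero_idx v|) delta_mx 0 (enum_val r).

Definition full_column_rank (R : realType) (k l : nat) (M : 'M[R]_(k, l)) : Prop :=
  \rank M = l.

Definition is_strict_local_min (R : realType) (k : nat)
    (g : 'cV[R]_k -> R) (D : set 'cV[R]_k) (x0 : 'cV[R]_k) : Prop :=
  D x0 /\
  exists2 U : set 'cV[R]_k, nbhs x0 U &
    forall x, U x -> D x -> x <> x0 -> g x0 < g x.

Record minmax_data (R : realType) (n m p q : nat) := MinmaxData {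
  Q11 : 'M[R]_n;
  Q12 : 'M[R]_(n, m);
  Q22 : 'M[R]_m;
  c_x : 'cV[R]_n;
  c_y : 'cV[R]_m;
  A_O : 'M[R]_(p, n);
  b_O : 'cV[R]_p;
  A_I : 'M[R]_(q, n);
  B_I : 'M[R]_(q, m);
  b_I : 'cV[R]_q
}.

Section Minmax.
Variables (R : realType) (n m p q : nat) (P : minmax_data R n m p q).
Implicit Types (x sO : 'cV[R]_n) (y sI : 'cV[R]_m).
Implicit Types (lO : 'cV[R]_p) (lI : 'cV[R]_q).

Definition objective x y : R :=
  2^-1 * quad_form (Q11 P) x + (x^T *m Q12 P *m y) 0 0
  - 2^-1 * quad_form (Q22 P) y
  + ((c_x P)^T *m x) 0 0 + ((c_y P)^T *m y) 0 0.

Definition outer_feasible : set 'cV[R]_n :=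
  [set x | A_O P *m x = b_O P /\ nonneg_vec x].

Definition inner_feasible x : set 'cV[R]_m :=
  [set y | A_I P *m x + B_I P *m y = b_I P /\ nonneg_vec y].

Definition inner_argmax x : set 'cV[R]_m :=
  [set y | inner_feasible x y /\
           forall z, inner_feasible x z -> objective x z <= objective x y].

(* The supremum is the attained maximum whenever [inner_argmax x] is nonempty;
   otherwise the value may be the junk value of [sup]. *)
Definition inner_value x : R := sup [set objective x y | y in inner_feasible x].

Definition outer_KKT x y lO sO lI : Prop :=
  [/\ Q11 P *m x + Q12 P *m y + c_x P + (A_I P)^T *m lI + (A_O P)^T *m lO - sO = 0,
      A_O P *m x - b_O P = 0,
      hadamard x sO = 0,
      nonneg_vec x &
      nonneg_vec sO].

Definition inner_KKT x y lI sI : Prop :=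
  [/\ - Q22 P *m y + (Q12 P)^T *m x + c_y P + (B_I P)^T *m lI + sI = 0,
      A_I P *m x + B_I P *m y - b_I P = 0,
      hadamard y sI = 0,
      nonneg_vec y &
      nonneg_vec sI].

Definition stationary x y lO sO lI sI : Prop :=
  [/\ outer_feasible x, inner_argmax x y, outer_KKT x y lO sO lI &
      inner_KKT x y lI sI].

Definition OLICQ x : Prop :=
  full_column_rank (row_mx (A_O P)^T (active_mx x)^T).

Definition ILICQ y : Prop :=
  full_column_rank (row_mx (B_I P)^T (active_mx y)^T).

Definition outer_tangent x : set 'cV[R]_n :=
  [set d | col_mx (A_O P) (active_mx x) *m d = 0].

Definition inner_tangent y : set 'cV[R]_m :=
  [set eta | col_mx (B_I P) (active_mx y) *m eta = 0].

Definition ISOSC y : Prop :=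
  forall eta, inner_tangent y eta -> eta <> 0 -> quad_form (- Q22 P) eta < 0.

Definition inner_KKT_mx y : 'M[R]_(m + (q + #|zero_idx y|)) :=
  block_mx (- Q22 P) (row_mx (B_I P)^T (active_mx y)^T)
           (col_mx (B_I P) (active_mx y)) 0.

(* [invmx] is the genuine inverse only when [inner_KKT_mx y] is nonsingular,
   which holds under ILICQ and ISOSC at [y] since Q22 is positive semidefinite. *)
Definition Q11' y : 'M[R]_n :=
  Q11 P - row_mx (Q12 P) (row_mx (A_I P)^T 0) *m invmx (inner_KKT_mx y)
          *m col_mx (Q12 P)^T (col_mx (A_I P) 0).

Definition OSOSC x y : Prop :=
  forall d, outer_tangent x d -> d <> 0 -> 0 < quad_form (Q11' y) d.

End Minmax.

(* min_i (s_i + v_i) > 0, for ISCS and OSCS. *)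
Definition strict_complementarity (R : realType) (k : nat) (s v : 'cV[R]_k) : Prop :=
  forall i, 0 < s i 0 + v i 0.

(* Main.v *)
Require Import Defs.
From HB Require Import structures.
From mathcomp Require Import all_boot all_order all_algebra.
From mathcomp Require Import all_classical all_reals all_analysis.
From mathcomp Require Import ring lra.
Import Order.TTheory GRing.Theory Num.Theory.
Import numFieldNormedType.Exports.
Local Open Scope classical_set_scope.
Local Open Scope ring_scope.

(** The idea is to bound the value function from below by the objective along a
    single, explicitly chosen response of the inner player.  For a displacement
    d of x the inner player moves y by e = Y d, where Y is the linear map
    obtained by solving the linearised inner KKT system with the active set of
    y kept fixed; that system is nonsingular by ILICQ and ISOSC
    ([inner_KKT_mx_unit], [inner_response]).  The point y + Y d satisfies the
    equality constraints of the inner problem at x + d, its active coordinates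
    stay 0, and its other coordinates stay positive as long as d is small
    ([near_coord_gt0]).  It is therefore feasible, and the value at x + d is at
    least f(x + d, y + Y d) ([inner_value_ge]).

    Since f is quadratic, f(x + d, y + Y d) - f(x, y) can be computed exactly.
    The KKT systems reduce the first-order part to sO . d when A_O d = 0
    ([objective_increment]), and eliminating the multiplier part of the
    linearised system shows that the second-order part is one half of the Schur
    complement form Q11' at d ([inner_response]).  So it remains to see that

      sO . d + (1/2) d^T Q11' d > 0

    for small nonzero feasible d.  Feasibility gives E d >= 0 for the active
    coordinates E d, and OSCS makes the weights of sO on them positive.  Split
    d = d1 + L E d with d1 in the tangent space and L linear.  The quadratic
    form then differs from its value at d1, which is positive unless d1 = 0 by
    OSOSC, by terms linear in E d with coefficients that tend to 0 with d;
    these are absorbed by the positive weights ([linear_quadratic_gt0]). *)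

(** * Inner products of column vectors *)

Definition dot {R : realType} {k : nat} (u v : 'cV[R]_k) : R := (u^T *m v) 0 0.

Section Dot.
Context {R : realType}.

Lemma dotE k (u v : 'cV[R]_k) : dot u v = \sum_i u i 0 * v i 0.
Proof. by rewrite /dot mxE; apply: eq_bigr => i _; rewrite mxE. Qed.

Lemma dotC k (u v : 'cV[R]_k) : dot u v = dot v u.
Proof. by rewrite !dotE; apply: eq_bigr => i _; rewrite mulrC. Qed.

Lemma dotDr k (u v w : 'cV[R]_k) : dot u (v + w) = dot u v + dot u w.
Proof. by rewrite /dot mulmxDr mxE. Qed.

Lemma dotNr k (u v : 'cV[R]_k) : dot u (- v) = - dot u v.
Proof. by rewrite /dot mulmxN mxE. Qed.

Lemma dotDl k (u v w : 'cV[R]_k) : dot (u + v) w = dot u w + dot v w.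
Proof. by rewrite dotC dotDr !(dotC _ w). Qed.

Lemma dotNl k (u v : 'cV[R]_k) : dot (- u) v = - dot u v.
Proof. by rewrite dotC dotNr dotC. Qed.

Lemma dot0r k (u : 'cV[R]_k) : dot u 0 = 0.
Proof. by rewrite /dot mulmx0 mxE. Qed.

Lemma dotZl k a (u v : 'cV[R]_k) : dot (a *: u) v = a * dot u v.
Proof. by rewrite /dot linearZ /= -scalemxAl mxE. Qed.

Lemma dot_trmx k l (M : 'M[R]_(k, l)) (u : 'cV[R]_k) (v : 'cV[R]_l) :
  dot (M^T *m u) v = dot u (M *m v).
Proof. by rewrite /dot trmx_mul trmxK mulmxA. Qed.

Lemma quad_formE k (Q : 'M[R]_k) (v : 'cV[R]_k) : quad_form Q v = dot v (Q *m v).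
Proof. by rewrite /quad_form /dot mulmxA. Qed.

End Dot.

(** * Active coordinates *)

Lemma active_mxE (R : realType) k (v d : 'cV[R]_k) r :
  (active_mx v *m d) r 0 = d (enum_val r) 0.
Proof.
have -> : (active_mx v *m d) r 0 = (row r (active_mx v *m d)) 0 0 by rewrite !mxE.
by rewrite row_mul rowK -rowE mxE.
Qed.

(** Complementarity kills the inactive coordinates of [s], so only the active
    ones contribute to an inner product with [s]. *)
Lemma active_mx_dot (R : realType) k (v s d : 'cV[R]_k) :
  hadamard v s = 0 -> dot s d = dot (active_mx v *m s) (active_mx v *m d).
Proof.
move=> hs; rewrite !dotE.
rewrite (bigID (fun i => i \in zero_idx v)) /= [X in _ + X]big1 ?addr0.
  by rewrite big_enum_val /=; apply: eq_bigr => r _; rewrite !active_mxE.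
move=> i; rewrite inE => vi.
move/matrixP/(_ i 0): hs; rewrite !mxE => /eqP.
by rewrite mulf_eq0 (negPf vi) /= => /eqP ->; rewrite mul0r.
Qed.

Lemma active_mx_eq0 (R : realType) k (v e : 'cV[R]_k) i :
  active_mx v *m e = 0 -> v i 0 = 0 -> e i 0 = 0.
Proof.
move=> he vi; have iv : i \in zero_idx v by rewrite inE vi.
by rewrite -(enum_rankK_in iv iv) -active_mxE he mxE.
Qed.

(** * Linear algebra *)

Lemma unitmx_inj_cV (F : fieldType) k (K : 'M[F]_k) :
  (forall v : 'cV[F]_k, K *m v = 0 -> v = 0) -> K \in unitmx.
Proof.
move=> hK; rewrite -unitmx_tr -row_free_unit -kermx_eq0; apply/rowV0P => v.
move/sub_kermxP => hv; apply: trmx_inj; rewrite trmx0; apply: hK.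
by rewrite -[K]trmxK -trmx_mul hv trmx0.
Qed.

Lemma full_column_rank_inj (R : realType) k l (M : 'M[R]_(k, l)) (v : 'cV[R]_l) :
  full_column_rank M -> M *m v = 0 -> v = 0.
Proof.
rewrite /full_column_rank => hM hv; apply: trmx_inj; rewrite trmx0.
have /row_free_inj : row_free M^T by rewrite /row_free mxrank_tr hM.
by move=> /(_ 1%N v^T 0); apply; rewrite mul0mx -trmx_mul hv trmx0.
Qed.

(** * Local positivity *)

Lemma near_coord_gt0 (R : realType) k l (v : 'cV[R]_k) (M : 'M[R]_(k, l))
    (x : 'cV[R]_l) :
  \forall x' \near x, forall i, 0 < v i 0 -> 0 < (v + M *m (x' - x)) i 0.
Proof.
have Fx : Filter (nbhs x) by exact: nbhs_filter.
suff near_i i : \forall x' \near x, 0 < v i 0 -> 0 < (v + M *m (x' - x)) i 0.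
  exact: (filter_forall Fx near_i).
have cf : (fun z : 'cV[R]_l => (v + M *m (z - x)) i 0) @ x --> (v i 0 : R).
  have -> : v i 0 = (v + M *m (x - x)) i 0 by rewrite subrr mulmx0 addr0.
  have -> : (fun z : 'cV[R]_l => (v + M *m (z - x)) i 0) =
     (fun z => v i 0 + \sum_j M i j * (z j 0 - x j 0)).
    apply/funext => z; rewrite !mxE; congr (_ + _).
    by apply: eq_bigr => j _; rewrite !mxE.
  rewrite !mxE; apply: cvgD; first by apply: cvg_cst.
  apply: cvg_big => [|j _]; [exact: add_continuous|rewrite !mxE].
  apply: cvgMr; apply: cvgB; last exact: cvg_cst.
  exact: coord_continuous.
have [hv|/negP hv] := boolP (0 < v i 0); last first.
  by apply: filterS (@filterT _ _ Fx) => z _ hv'; case: hv.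
by apply: filterS (cvgr_gt _ cf _ hv) => z.
Qed.

Lemma dot_ge0 (R : realType) k (a u : 'cV[R]_k) :
  (forall i, 0 < a i 0) -> nonneg_vec u -> 0 <= dot a u.
Proof.
by move=> ha hu; rewrite dotE sumr_ge0 // => i _; rewrite mulr_ge0 ?hu ?ltW.
Qed.

Lemma dot_gt0 (R : realType) k (a u : 'cV[R]_k) :
  (forall i, 0 < a i 0) -> nonneg_vec u -> u != 0 -> 0 < dot a u.
Proof.
move=> ha hu u0; rewrite lt0r dot_ge0 // andbT.
apply: contra u0; rewrite dotE psumr_eq0 => [/allP h|i _]; last first.
  by rewrite mulr_ge0 ?hu ?ltW.
apply/eqP/matrixP => i j; rewrite (ord1 j) mxE.
move: (h i (mem_index_enum i)) => /=.
by rewrite mulf_eq0 gt_eqF //= => /eqP.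
Qed.

(** The assumptions give first-order growth along [E *m d] and second-order
    growth on the kernel of [col_mx A E]; they combine because a vector with
    [A *m d = 0] differs from a kernel vector [d1] by a linear function of
    [u = E *m d].  The expression equals
    [2^-1 * quad_form H d1 + dot (s + 2^-1 *: (G *m d)) u] for some matrix [G],
    and the weight of [u] stays positive near [x]. *)
Lemma linear_quadratic_gt0 (R : realType) (n p r : nat) (H : 'M[R]_n)
    (A : 'M[R]_(p, n)) (E : 'M[R]_(r, n)) (s : 'cV[R]_r) (x : 'cV[R]_n) :
  (forall i, 0 < s i 0) ->
  (forall d : 'cV[R]_n, col_mx A E *m d = 0 -> d <> 0 -> 0 < quad_form H d) ->
  \forall x' \near x, A *m (x' - x) = 0 -> nonneg_vec (E *m (x' - x)) ->
    x' <> x -> 0 < dot s (E *m (x' - x)) + 2^-1 * quad_form H (x' - x).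
Proof.
move=> s0 Hpos.
pose C := col_mx A E.
(* [pinvmx C *m C *m d] has the same image under [C] as [d]; when [A *m d = 0]
   it only depends on [E *m d], through [L]. *)
pose L : 'M[R]_(n, r) := pinvmx C *m col_mx 0 1%:M.
pose G := (H *m L)^T *m (1%:M - L *m E) + L^T *m H.
have Fx : Filter (nbhs x) by exact: nbhs_filter.
apply: filterS (near_coord_gt0 _ _ _ s (2^-1 *: G) x) => x' near_s'.
have near_s i : 0 < (s + (2^-1 *: G) *m (x' - x)) i 0 by exact: near_s'.
move=> Ad0 u0 /eqP; rewrite -subr_eq0 => d0.
move: (x' - x) near_s Ad0 u0 d0 {near_s'} => d near_s Ad0 u0 d0.
set u := E *m d in u0 *.
(* [d1] is introduced opaquely so that [ring] treats it as an atom. *)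
have [d1 d1E] : exists d1, d1 = d - L *m u by exists (d - L *m u).
have Cd : C *m d = col_mx 0 1%:M *m u.
  by rewrite /C !mul_col_mx Ad0 mul0mx mul1mx.
have Cd1 : C *m d1 = 0.
  rewrite d1E mulmxBr /L -(mulmxA (pinvmx C)) -Cd.
  by rewrite [X in _ - X]mulmxA [X in _ - X]mulmxA mulmxKpV ?subrr.
have quadE : quad_form H d = quad_form H d1 + dot (G *m d) u.
  have d1_lin : d1 = (1%:M - L *m E) *m d by rewrite mulmxBl mul1mx -(mulmxA L).
  rewrite /G mulmxDl -[(H *m L)^T *m _ *m d]mulmxA -d1_lin dotDl dot_trmx.
  rewrite -[L^T *m H *m d]mulmxA dot_trmx !quad_formE.
  rewrite [dot (H *m d) _]dotC -mulmxA.
  have -> : H *m (L *m u) = H *m d - H *m d1.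
    by rewrite -mulmxBr d1E opprB addrC subrK.
  have -> : L *m u = d - d1 by rewrite d1E opprB addrC subrK.
  rewrite dotDr dotDl dotNr dotNl; ring.
rewrite quadE.
have -> : dot s u + 2^-1 * (quad_form H d1 + dot (G *m d) u) =
   2^-1 * quad_form H d1 + dot (s + (2^-1 *: G) *m d) u.
  by rewrite dotDl -scalemxAl dotZl; ring.
have [d1_0|d1_0] := eqVneq d1 0.
  rewrite d1_0 quad_formE mulmx0 dot0r mulr0 add0r.
  apply: dot_gt0 => //; apply: contra d0 => /eqP uz.
  by rewrite -d1_0 d1E uz mulmx0 subr0.
apply: ltr_wpDr; first exact: dot_ge0.
by rewrite mulr_gt0 ?invr_gt0 ?ltr0n //; apply: Hpos => //; apply/eqP.
Qed.

(** * Inner response and value function *)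

Section MinmaxTheory.
Context {R : realType} {n m p q : nat}.
Variable P : minmax_data R n m p q.

(** For a kernel vector with primal part [e] and multipliers [mu], [nu], pairing
    the first block row with [e] leaves the value of the form [- Q22 P] at the
    tangent vector [e], so ISOSC forces [e = 0]; then ILICQ kills [mu], [nu]. *)
Lemma inner_KKT_mx_unit (y : 'cV[R]_m) :
  ILICQ P y -> ISOSC P y -> inner_KKT_mx P y \in unitmx.
Proof.
move=> hI hS; apply: unitmx_inj_cV => v.
rewrite -[v]vsubmxK -[dsubmx v]vsubmxK.
set e := usubmx v; set mu := usubmx _; set nu := dsubmx _.
rewrite /inner_KKT_mx mul_block_col mul_row_col mul0mx addr0.
move/eqP; rewrite col_mx_eq0 => /andP[/eqP h1 /eqP h2].
have [Be Ee] : B_I P *m e = 0 /\ active_mx y *m e = 0.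
  by move/eqP: h2; rewrite mul_col_mx col_mx_eq0 => /andP[/eqP -> /eqP ->].
have quad0 : quad_form (- Q22 P) e = 0.
  have : dot e (- Q22 P *m e + ((B_I P)^T *m mu + (active_mx y)^T *m nu)) = 0.
    by rewrite h1 dot0r.
  rewrite dotDr -quad_formE dotDr !(dotC _ _ (_ *m _)) !dot_trmx Be Ee.
  by rewrite !dot0r !addr0.
have e0 : e = 0.
  apply/eqP; apply: contraT => /eqP e0.
  by have := hS e h2 e0; rewrite quad0 ltxx.
have : row_mx (B_I P)^T (active_mx y)^T *m col_mx mu nu = 0.
  by rewrite mul_row_col -h1 e0 mulmx0 add0r.
by move/(full_column_rank_inj _ _ _ _ _ hI) => ->; rewrite e0 col_mx0.
Qed.

(** [Y] is the derivative of the inner solution with respect to [x] when the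
    active set is frozen: the primal block of the solution of the linearised
    inner KKT system.  The last identity says that [Q11'] is the Hessian seen by
    the outer player once the inner one reacts by [Y]: pairing the first block
    row of the system with the response rewrites the multiplier contribution to
    [Q11'] in terms of the response alone. *)
Lemma inner_response (y : 'cV[R]_m) : inner_KKT_mx P y \in unitmx ->
  exists Y : 'M[R]_(m, n), forall d : 'cV[R]_n,
    [/\ A_I P *m d + B_I P *m (Y *m d) = 0,
        active_mx y *m (Y *m d) = 0 &
        quad_form (Q11' P y) d =
          quad_form (Q11 P) d + 2 * dot d (Q12 P *m (Y *m d))
          - quad_form (Q22 P) (Y *m d)].
Proof.
move=> Ku.
pose N : 'M[R]_(m + (q + #|zero_idx y|), n) :=
  col_mx (Q12 P)^T (col_mx (A_I P) 0).
pose W := - (invmx (inner_KKT_mx P y) *m N).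
have KW : inner_KKT_mx P y *m W = - N by rewrite mulmxN mulKVmx.
exists (usubmx W) => d.
have [e Ye] : exists e, e = usubmx W *m d by exists (usubmx W *m d).
have [mu muE] : exists mu, mu = usubmx (dsubmx W) *m d.
  by exists (usubmx (dsubmx W) *m d).
have [nu nuE] : exists nu, nu = dsubmx (dsubmx W) *m d.
  by exists (dsubmx (dsubmx W) *m d).
have Wd : W *m d = col_mx e (col_mx mu nu).
  by rewrite -[W]vsubmxK -[dsubmx W]vsubmxK !mul_col_mx Ye muE nuE.
rewrite -Ye.
have : inner_KKT_mx P y *m (W *m d) = - (N *m d) by rewrite mulmxA KW mulNmx.
rewrite Wd /inner_KKT_mx mul_block_col mul_row_col mul0mx addr0 mul_col_mx.
rewrite /N !mul_col_mx mul0mx !opp_col_mx oppr0.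
move=> /eq_col_mx [h1 /eq_col_mx [h2 h3]].
split => //; first by rewrite h2 subrr.
have Q11'd : Q11' P y *m d =
    Q11 P *m d + (Q12 P *m e + (A_I P)^T *m mu).
  rewrite /Q11' mulmxBl -!mulmxA -/N.
  have -> : invmx (inner_KKT_mx P y) *m (N *m d) = - (W *m d).
    by rewrite /W mulNmx opprK mulmxA.
  by rewrite Wd mulmxN opprK !mul_row_col mul0mx addr0.
have muB : dot mu (B_I P *m e) = - dot mu (A_I P *m d) by rewrite h2 dotNr.
have : dot e (- Q22 P *m e + ((B_I P)^T *m mu + (active_mx y)^T *m nu))
     = dot e (- ((Q12 P)^T *m d)) by rewrite h1.
rewrite !dotDr mulNmx !dotNr !(dotC _ e (_^T *m _)) !dot_trmx h3 dot0r muB.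
rewrite !quad_formE Q11'd !dotDr (dotC _ d (_^T *m _)) dot_trmx.
move=> h; lra.
Qed.

Lemma objective_shift (x d : 'cV[R]_n) (y e : 'cV[R]_m) :
  (Q11 P)^T = Q11 P -> (Q22 P)^T = Q22 P ->
  objective P (x + d) (y + e) = objective P x y
    + dot (Q11 P *m x + Q12 P *m y + c_x P) d
    + dot (- Q22 P *m y + (Q12 P)^T *m x + c_y P) e
    + (2^-1 * quad_form (Q11 P) d + dot d (Q12 P *m e)
       - 2^-1 * quad_form (Q22 P) e).
Proof.
move=> s1 s2; rewrite /objective -!mulmxA -!/(dot _ _) !quad_formE.
rewrite !mulmxDr !mulNmx !dotDl !dotDr !dotNl dot_trmx.
have := dot_trmx _ _ (Q11 P) x d; have := dot_trmx _ _ (Q22 P) y e.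
rewrite s1 s2 (dotC _ (Q12 P *m y)) (dotC _ d (Q11 P *m x)) (dotC _ e (Q22 P *m y)).
move=> -> ->; lra.
Qed.

Lemma inner_value_ge (x : 'cV[R]_n) (y : 'cV[R]_m) :
  inner_argmax P x !=set0 -> inner_feasible P x y ->
  objective P x y <= inner_value P x.
Proof.
move=> [z [_ zmax]] hy; apply: ub_le_sup; last by exists y.
by exists (objective P x z) => _ [w hw <-]; apply: zmax.
Qed.

Lemma inner_value_argmax (x : 'cV[R]_n) (y : 'cV[R]_m) :
  inner_argmax P x y -> inner_value P x = objective P x y.
Proof.
move=> [hy ymax]; apply/eqP; rewrite eq_le inner_value_ge ?andbT //; last first.
  by exists y.
by apply: ge_sup => [|_ [w hw <-]]; [exists (objective P x y); exists y|exact: ymax].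
Qed.

(** The gradients in [x] and [y] are combinations of multipliers.  The terms in
    [lI] cancel because the move preserves the coupling constraint, the one in
    [lO] vanishes by [A_O P *m d = 0], and the one in [sI] by complementarity,
    as [e] does not move the active coordinates. *)
Lemma objective_increment (x d : 'cV[R]_n) (y e : 'cV[R]_m)
    (lO : 'cV[R]_p) (sO : 'cV[R]_n) (lI : 'cV[R]_q) (sI : 'cV[R]_m) :
  (Q11 P)^T = Q11 P -> (Q22 P)^T = Q22 P ->
  outer_KKT P x y lO sO lI -> inner_KKT P x y lI sI ->
  A_O P *m d = 0 -> A_I P *m d + B_I P *m e = 0 -> active_mx y *m e = 0 ->
  objective P (x + d) (y + e) = objective P x y + dot sO d
    + (2^-1 * quad_form (Q11 P) d + dot d (Q12 P *m e)
       - 2^-1 * quad_form (Q22 P) e).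
Proof.
move=> s1 s2 [gx _ _ _ _] [gy _ ysI _ _] AOd ABde Ee.
rewrite objective_shift //.
have Edx : dot (Q11 P *m x + Q12 P *m y + c_x P) d
    + dot lI (A_I P *m d) = dot sO d.
  have := dot0r _ d; rewrite dotC -gx.
  by rewrite !(dotDl, dotNl) !dot_trmx AOd dot0r => h; lra.
have Edy : dot (- Q22 P *m y + (Q12 P)^T *m x + c_y P) e
    + dot lI (B_I P *m e) = 0.
  have := dot0r _ e; rewrite dotC -gy.
  rewrite [dot (_ + sI) e]dotDl (active_mx_dot _ _ _ _ _ ysI) Ee dot0r addr0.
  by rewrite [dot (_ + _^T *m lI) e]dotDl dot_trmx.
have := dotDr q lI (A_I P *m d) (B_I P *m e); rewrite ABde dot0r.
lra.
Qed.

End MinmaxTheory.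

Theorem theorem2p7 (R : realType) (n m p q : nat)
  (hpn : (p < n)%N) (hqm : (q < m)%N)
  (P : minmax_data R n m p q)
  (hQ11 : sym_psd (Q11 P)) (hQ22 : sym_psd (Q22 P))
  (hS : forall x, outer_feasible P x -> inner_argmax P x !=set0)
  (x : 'cV[R]_n) (y : 'cV[R]_m)
  (lO : 'cV[R]_p) (sO : 'cV[R]_n) (lI : 'cV[R]_q) (sI : 'cV[R]_m)
  (hstat : stationary P x y lO sO lI sI)
  (hILICQ : ILICQ P y)
  (hISCS : strict_complementarity sI y)
  (hISOSC : ISOSC P y)
  (hOLICQ : OLICQ P x)
  (hOSCS : strict_complementarity sO x)
  (hOSOSC : OSOSC P x y) :
  is_strict_local_min (inner_value P) (outer_feasible P) x.
Proof.
have [xX yS outer inner] := hstat.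
have [AOx xge0] := xX.
have [[yfeas yge0] _] := yS.
have [Y HY] := inner_response P y (inner_KKT_mx_unit P y hILICQ hISOSC).
have sO_gt0 r : 0 < (active_mx x *m sO) r 0.
  rewrite active_mxE; have := hOSCS (enum_val r).
  have := enum_valP r; rewrite inE => /eqP ->.
  by rewrite addr0.
have growth := linear_quadratic_gt0 _ _ _ _ _ _ _ _ x sO_gt0 hOSOSC.
have stable := near_coord_gt0 _ _ _ y Y x.
have Fx : Filter (nbhs x) by exact: nbhs_filter.
split => //; eexists; first exact: (filterI growth stable).
move=> x' [gr st] x'X x'x.
have [AOx' x'ge0] := x'X.
have [ABde Ee quadE] := HY (x' - x).
have AOd : A_O P *m (x' - x) = 0 by rewrite mulmxBr AOx AOx' subrr.
have Ed_ge0 : nonneg_vec (active_mx x *m (x' - x)).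
  move=> r; rewrite active_mxE !mxE.
  (* An active coordinate of [x] is 0, so the displacement is that of [x']. *)
  by have := enum_valP r; rewrite inE => /eqP ->; rewrite subr0.
have x'E : x' = x + (x' - x) by rewrite addrC subrK.
have y'feas : inner_feasible P x' (y + Y *m (x' - x)).
  split.
    by rewrite {1}x'E (mulmxDr _ x) (mulmxDr _ y) addrACA yfeas ABde addr0.
  (* Active coordinates of [y] are not moved by the response; the others are
     positive and stay so near [x]. *)
  move=> i; have := yge0 i; rewrite le_eqVlt => /orP[/eqP yi|/st/ltW //].
  by rewrite mxE -yi (active_mx_eq0 _ _ _ _ _ Ee) ?addr0.
apply: lt_le_trans (inner_value_ge P _ _ (hS x' x'X) y'feas).
rewrite (inner_value_argmax P _ _ yS) [X in _ < objective P X _]x'E.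
rewrite (objective_increment P _ _ _ _ _ _ _ _ hQ11.1 hQ22.1 outer inner AOd ABde Ee).
have [_ _ xsO _ _] := outer.
move: (gr AOd Ed_ge0 x'x); rewrite -(active_mx_dot _ _ _ _ _ xsO) quadE.
by lra.
Qed.
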